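(* Let $G$ be a finite bipartite graph with bipartition $(X,Y)$ and let $G^+$ be its auxiliary graph. Then $G$ is a cocomparability bigraph if and only if $G^+$ is bipartite. Moreover, if $G^+$ is not bipartite, then any odd cycle of $G^+$ yields a weak edge-asteroid of $G$.
   Context: Let $\mathcal F$ be the set of ordered pairs $(u,v)$ of distinct vertices both in $X$ or both in $Y$. Two edges $xy,x'y'$ ($x,x'\in X$, $y,y'\in Y$) are independent if they are disjoint and $xy'\notin E(G)$, $x'y\notin E(G)$. The auxiliary graph $G^+$ has vertex set $\mathcal F$, in which $(u,v)$ is adjacent to $(v,u)$ and to every $(z,w)\in\mathcal F$ such that $uw$ and $vz$ are independent edges of $G$. $G$ is a cocomparability bigraph if there exist linear orderings $\prec_X$ of $X$ and $\prec_Y$ of $Y$ such that for all $u,v\in X$, $w,z\in Y$ with $u\prec_X v$, $w\prec_Y z$ and $uz,vw\in E(G)$, at least one of $uw,vz$ is in $E(G)$. A weak edge-asteroid in $G$ is a family of $2k+1$ ($k\ge1$) edges $e_0,\dots,e_{2k}$, not necessarily distinct, such that for each $i$ there is a walk containing both end vertices of $e_{i+k}$ and both end vertices of $e_{i+k+1}$ and no vertex adjacent to an end vertex of $e_i$ (indices mod $2k+1$). *)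

(* Defs.v *)
From mathcomp Require Import all_boot.

Set Implicit Arguments.
Unset Strict Implicit.
Unset Printing Implicit Defensive.

(* A finite simple graph is a symmetric irreflexive relation on a finType. *)

Definition bipartition (V : finType) (e : rel V) (X Y : {set V}) : Prop :=
  [/\ X :|: Y = [set: V], [disjoint X & Y] &
      forall u v, e u v ->
        (u \in X /\ v \in Y) \/ (u \in Y /\ v \in X)].

Definition bipartite (V : finType) (e : rel V) : Prop :=
  exists A B : {set V}, bipartition e A B.

(* The condition 2 < size c excludes degenerate cycles (loops, repeated
   edges) accepted by [ucycle]. *)
Definition odd_cycle (V : finType) (e : rel V) (c : seq V) : Prop :=
  [/\ 2 < size c, odd (size c) & ucycle e c].

Definition strict_linear_order_on (V : finType) (A : {set V}) (r : rel V) :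
    Prop :=
  [/\ {in A, irreflexive r},
      {in A & &, transitive r} &
      {in A &, forall x y, x != y -> r x y || r y x}].

Definition cocomparability_bigraph (V : finType) (e : rel V) (X Y : {set V}) :
    Prop :=
  exists ltX ltY : rel V,
  [/\ strict_linear_order_on X ltX,
      strict_linear_order_on Y ltY &
      forall u v w z,
        u \in X -> v \in X -> w \in Y -> z \in Y ->
        ltX u v -> ltY w z -> e u z -> e v w ->
        e u w \/ e v z].

(* xy and x'y' are independent edges, with x, x' in X and y, y' in Y. *)
Definition independent_XY (V : finType) (e : rel V) (X Y : {set V})
    (x y x' y' : V) : bool :=
  [&& [&& x \in X, x' \in X, y \in Y & y' \in Y],
      e x y, e x' y',
      [disjoint [set x; y] & [set x'; y']],
      ~~ e x y' & ~~ e x' y].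

(* The same for ab and cd regarded as unordered pairs, where a and c are known
   to lie on the same side of the bipartition. *)
Definition independent (V : finType) (e : rel V) (X Y : {set V})
    (a b c d : V) : bool :=
  independent_XY e X Y a b c d || independent_XY e X Y b a d c.

Definition same_side_pair (V : finType) (X Y : {set V}) (p : V * V) : bool :=
  (p.1 != p.2) &&
  ((p.1 \in X) && (p.2 \in X) || (p.1 \in Y) && (p.2 \in Y)).

Definition aux_vertex (V : finType) (X Y : {set V}) : finType :=
  {p : V * V | same_side_pair X Y p}.

Definition aux_graph (V : finType) (e : rel V) (X Y : {set V}) :
    rel (aux_vertex X Y) :=
  fun p q =>
    let: (u, v) := val p in
    let: (z, w) := val q in
    ((z, w) == (v, u)) || independent e X Y u w v z.

(* An edge is given by the ordered pair of its end vertices, in either order. *)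
Definition weak_edge_asteroid (V : finType) (e : rel V) (k : nat)
    (f : 'I_(k.*2.+1) -> V * V) : Prop :=
  [/\ 1 <= k,
      forall i, e (f i).1 (f i).2 &
      forall i : 'I_(k.*2.+1),
        let a := f (inord ((i + k) %% k.*2.+1)) in
        let b := f (inord ((i + k.+1) %% k.*2.+1)) in
        exists x (s : seq V),
        [/\ path e x s,
            {subset [:: a.1; a.2; b.1; b.2] <= x :: s} &
            {in x :: s, forall z, ~~ e z (f i).1 && ~~ e z (f i).2}]].

(* g is one of the two edges uw, vz that make consecutive vertices (u, v),
   (z, w) of the cycle c of the auxiliary graph adjacent. At a step from (u, v)
   to (v, u) both pairs are degenerate, so such a step contributes no edge. *)
Definition edge_of_cycle (V : finType) (X Y : {set V})
    (c : seq (aux_vertex X Y)) (g : V * V) : Prop :=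
  exists2 p, p \in c &
    let: (u, v) := val p in
    let: (z, w) := val (next c p) in
    g = (u, w) \/ g = (v, z).

(* Main.v *)
(* Two edges u w, v z of an induced 2K2 force u before v exactly when w comes
   before z, so a proper 2-colouring of the auxiliary graph is an orientation of
   the same-side pairs constant on the classes of forced pairs. To get transitive
   orders, orient each class like its lexicographically smallest pair. Pairs of
   vertices with nested neighbourhoods are unforced and never lie on a cyclic
   triangle if ordered by inclusion. A cyclic triangle x, y, z of forced pairs
   spans an induced 3K2, or the bipartite complement of one; there, as (y, z)
   moves through its class, x remains the third vertex of a cyclic triangle of the
   same classes (as in Gallai's and Golumbic's triangle lemma), and the
   lexicographic choice then contradicts itself. Columns are handled by
   transporting the orientation of rows.

   For the asteroid: along a closed walk of odd length n = 2k+1 in the auxiliary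
   graph, alternating first and second components gives two parallel walks in the
   graph with no edge between consecutive positions; e_i is the edge at step 2i. *)

Require Import Defs.
From mathcomp Require Import all_boot.

Set Implicit Arguments.
Unset Strict Implicit.
Unset Printing Implicit Defensive.

(** * Induced 2K2 patterns in a 0/1 matrix and their forcing classes *)

(** Rows and columns have separate types and [M] is an arbitrary relation, so that results transfer
    to the bipartite complement and to the transpose. *)
Definition separates (T U : finType) (M : T -> U -> bool) u v w z :=
  [&& M u w, M v z, ~~ M u z & ~~ M v w].

Definition incomparable (T U : finType) (M : T -> U -> bool) u v :=
  [exists w, exists z, separates M u v w z].

(** Two steps of the auxiliary graph, through the common neighbour [(z, w)]; a proper 2-colouring
    gives [p] and [q] the same colour. *)
Definition forcing (T U : finType) (M : T -> U -> bool) : rel (T * T) :=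
  fun p q => [exists w, exists z,
    separates M p.1 p.2 w z && separates M q.1 q.2 w z].

Definition equiforced (T U : finType) (M : T -> U -> bool) : rel (T * T) :=
  connect (forcing M).

Definition induced_matching (T U : finType) (M : T -> U -> bool)
    x y z p b c :=
  [&& M x p, M y b, M z c,
      [&& ~~ M x b, ~~ M x c & ~~ M y p] &
      [&& ~~ M y c, ~~ M z p & ~~ M z b]].

Definition complement (T U : finType) (M : T -> U -> bool) : T -> U -> bool :=
  fun u w => ~~ M u w.

Definition orients (T U : finType) (M : T -> U -> bool) (D : rel T) : Prop :=
  [/\ forall u v, D u v -> incomparable M u v,
      forall u v, D u v -> ~~ D v u,
      forall u v, incomparable M u v -> D u v || D v u &
      forall u v u' v' w z, separates M u v w z -> separates M u' v' w z ->
        D u v -> D u' v'].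

Section Rows.
Variables (T U : finType) (M : T -> U -> bool).
Local Notation sep := (separates M).
Local Notation inc := (incomparable M).
Local Notation "p ~~> q" := (equiforced M p q) (at level 70).

Lemma separatesC u v w z : sep u v w z = sep v u z w.
Proof.
by rewrite /separates; case: (M u w); case: (M v z); case: (M u z); case: (M v w).
Qed.

Lemma separates_complement u v w z :
  separates (complement M) u v w z = sep u v z w.
Proof.
rewrite /separates /complement.
by case: (M u w); case: (M v z); case: (M u z); case: (M v w).
Qed.

Lemma incomparableP u v :
  reflect (exists w z, sep u v w z) (inc u v).
Proof.
apply: (iffP existsP) => [[w /existsP[z h]]|[w [z h]]]; exists w; first by exists z.
by apply/existsP; exists z.
Qed.

Lemma incomparableC u v : inc u v = inc v u.
Proof.
by apply/incomparableP/incomparableP => [] [w [z h]]; exists z, w; rewrite separatesC.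
Qed.

Lemma forcingP u v u' v' :
  reflect (exists w z, sep u v w z /\ sep u' v' w z) (forcing M (u, v) (u', v')).
Proof.
apply: (iffP existsP) => [[w /existsP[z /andP[h h']]]|[w [z [h h']]]].
  by exists w, z.
by exists w; apply/existsP; exists z; apply/andP.
Qed.

Lemma forcing_sym : symmetric (forcing M).
Proof.
by move=> [u v] [u' v']; apply/forcingP/forcingP => [] [w [z [h h']]]; exists w, z.
Qed.

Lemma equiforced_refl p : p ~~> p.
Proof. exact: connect0. Qed.

Lemma equiforced_sym p q : (p ~~> q) = (q ~~> p).
Proof. exact: (sym_connect_sym forcing_sym). Qed.

Lemma equiforced_trans q p r : p ~~> q -> q ~~> r -> p ~~> r.
Proof. exact: connect_trans. Qed.

Lemma separates_equiforced w z u v u' v' :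
  sep u v w z -> sep u' v' w z -> (u, v) ~~> (u', v').
Proof. by move=> h h'; apply/connect1/forcingP; exists w, z. Qed.

Lemma equiforced_swap u v u' v' :
  (u, v) ~~> (u', v') -> (v, u) ~~> (v', u').
Proof.
case/connectP=> s; elim: s u v => [|[a b] s IH] u v /=.
  by move=> _ [-> ->]; apply: equiforced_refl.
case/andP=> /forcingP[w [z [h h']]] ps def.
apply: equiforced_trans (IH _ _ ps def).
by apply: (@separates_equiforced z w); rewrite separatesC.
Qed.

(* The edge [x p] of the induced matching stays fixed while the pair of rows
   [(y, z)] ranges over its class: this is what makes the lexicographic choice
   below work. *)
Lemma triangle_step x y z y' z' p b c :
  induced_matching M x y z p b c ->
  ~~ ((y, z) ~~> (x, z)) -> ~~ ((y, z) ~~> (y, x)) ->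
  forcing M (y, z) (y', z') ->
  exists b' c', [/\ induced_matching M x y' z' p b' c',
    (x, y) ~~> (x, y') & (x, z) ~~> (x, z')].
Proof.
case/and5P=> xp yb zc /and3P[xb xc yp] /and3P[yc zp zb] nB nC.
case/forcingP=> b1 [c1 [h h']]; exists b1, c1.
have via u v u' v' w w' : (y, z) ~~> (u, v) ->
    sep u v w w' -> sep u' v' w w' -> (y, z) ~~> (u', v').
  by move=> yzuv s s'; apply: equiforced_trans yzuv (separates_equiforced s s').
have h0 := separates_equiforced h h'.
case/and4P: (h) => yb1 zc1 yc1 zb1; case/and4P: (h') => yb1' zc1' yc1' zb1'.
(* Each of the four unwanted entries would force [(y, z)] onto [(x, z)] or [(y, x)]. Column [c]
   stands in for [c1] when [x] meets both [b1] and [c1]. *)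
have xb1 : ~~ M x b1.
  apply/negP=> xb1; have [xc1|xc1] := boolP (M x c1).
    case/negP: nB; apply: (@via y z x z b1 c); first exact: equiforced_refl.
      by apply/and4P.
    by apply/and4P.
  case/negP: nB; apply: (@via y z x z b1 c1) => //; first exact: equiforced_refl.
  by apply/and4P.
have xc1 : ~~ M x c1.
  apply/negP=> xc1; case/negP: nC.
  apply: (@via y z y x b1 c1) => //; first exact: equiforced_refl.
  by apply/and4P.
have yp' : ~~ M y' p.
  apply/negP=> yp'; case/negP: nB; have [zp'|zp'] := boolP (M z' p).
    have h1 : (y, z) ~~> (y', z).
      by apply: (@via y z y' z b1 c1) => //; [exact: equiforced_refl|apply/and4P].
    by apply: (@via y' z x z p c1) => //; apply/and4P.
  have h1 : (y, z) ~~> (x, z').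
    by apply: (@via y' z' x z' p c1) => //; apply/and4P.
  by apply: (@via x z' x z p c1) => //; apply/and4P.
have zp' : ~~ M z' p.
  apply/negP=> zp'; case/negP: nC.
  have h1 : (y, z) ~~> (y', x).
    by apply: (@via y' z' y' x b1 p) => //; apply/and4P.
  by apply: (@via y' x y x b1 p) => //; apply/and4P.
split; first by apply/and5P; split=> //; apply/and3P.
  by apply: (@separates_equiforced p b1); apply/and4P.
by apply: (@separates_equiforced p c1); apply/and4P.
Qed.

(** Iterates [triangle_step] along a chain of forcings. The two negative hypotheses persist because
    no step changes the classes of the three sides. *)
Lemma triangle_lemma x y z y' z' p b c :
  induced_matching M x y z p b c ->
  ~~ ((y, z) ~~> (x, z)) -> ~~ ((y, z) ~~> (y, x)) ->
  (y, z) ~~> (y', z') ->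
  exists b' c', [/\ induced_matching M x y' z' p b' c',
    (x, y) ~~> (x, y') & (x, z) ~~> (x, z')].
Proof.
move=> m nB nC /connectP[s]; elim: s y z b c m nB nC => [|[y1 z1] s IH] y z b c m nB nC /=.
  by move=> _ [-> ->]; exists b, c; split=> //; apply: equiforced_refl.
case/andP=> st ps def.
have [b1 [c1 [m1 xy1 xz1]]] := triangle_step m nB nC st.
have yz1 : (y, z) ~~> (y1, z1) by apply: connect1.
have nB1 : ~~ ((y1, z1) ~~> (x, z1)).
  apply: contra nB => h; apply: equiforced_trans yz1 (equiforced_trans h _).
  by rewrite equiforced_sym.
have nC1 : ~~ ((y1, z1) ~~> (y1, x)).
  apply: contra nC => h; apply: equiforced_trans yz1 (equiforced_trans h _).
  by rewrite equiforced_sym; apply: equiforced_swap.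
have [b2 [c2 [m2 xy2 xz2]]] := IH _ _ _ _ m1 nB1 nC1 ps def.
exists b2, c2; split=> //; first exact: equiforced_trans xy1 xy2.
exact: equiforced_trans xz1 xz2.
Qed.

(** * Orientations compatible with forcing *)

Lemma orients_equiforced D u v u' v' :
  orients M D -> (u, v) ~~> (u', v') -> D u v -> D u' v'.
Proof.
case=> _ _ _ Dinv /connectP[s]; elim: s u v => [|[a b] s IH] u v /=.
  by move=> _ [-> ->].
case/andP=> /forcingP[w [z [h h']]] ps def Duv.
exact: IH ps def (Dinv _ _ _ _ _ _ h h' Duv).
Qed.

(** Let [b], [c] separate [y], [z] and [p], [q] separate [x], [y]. If [x] told [b] from [c], or [z]
    told [p] from [q], it could replace an end of that side and reverse an arc of the triangle. Both
    rows zero there gives an induced 3K2, both one its complement, and the mixed cases again reverse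
    an arc. *)
Lemma cyclic_triangle_matching D x y z :
  orients M D -> D x y -> D y z -> D z x ->
  exists p b c, induced_matching M x y z p b c
             \/ induced_matching (complement M) x y z p b c.
Proof.
case=> Dinc Danti _ Dinv Dxy Dyz Dzx.
have nxz := Danti _ _ Dzx; have nyx := Danti _ _ Dxy; have nzy := Danti _ _ Dyz.
case/incomparableP: (Dinc _ _ Dyz) => b [c h]; case/and4P: (h) => yb zc yc zb.
case/incomparableP: (Dinc _ _ Dxy) => p [q h']; case/and4P: (h') => xp yq xq yp.
have xbc : M x b = M x c.
  have [xb|xb] := boolP (M x b); have [xc|xc] := boolP (M x c) => //.
    by case/negP: nxz; apply: Dinv h _ Dyz; apply/and4P.
  by case/negP: nyx; apply: Dinv h _ Dyz; apply/and4P.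
have zpq : M z p = M z q.
  have [zp|zp] := boolP (M z p); have [zq|zq] := boolP (M z q) => //.
    by case/negP: nzy; apply: Dinv h' _ Dxy; apply/and4P.
  by case/negP: nxz; apply: Dinv h' _ Dxy; apply/and4P.
have [xb|xb] := boolP (M x b); have [zp|zp] := boolP (M z p);
  rewrite ?xb ?(negbTE xb) in xbc; rewrite ?zp ?(negbTE zp) in zpq.
- exists q, c, b; right.
  by rewrite /induced_matching /complement !negbK -xbc -zpq xq yq yc yb xb zb zc.
- case/negP: nyx; apply: (@Dinv y z y x q c) => //.
    by apply/and4P; split=> //; rewrite -zpq.
  by apply/and4P; rewrite -xbc.
- case/negP: nzy; apply: (@Dinv x y z y p b) => //; apply/and4P; split=> //.
- exists p, q, c; left.
  by apply/and5P; split=> //; apply/and3P; rewrite -?xbc -?zpq.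
Qed.

(** * Extending an acyclic orientation to a linear order *)

Definition row_subset u v := [forall w, M u w ==> M v w].

Lemma incomparableE u v : inc u v = ~~ row_subset u v && ~~ row_subset v u.
Proof.
rewrite !negb_forall; apply/incomparableP/andP => [[w [z /and4P[uw vz uz vw]]]|].
  by split; apply/existsP; [exists w; rewrite uw|exists z; rewrite vz].
case=> /existsP[w]; rewrite negb_imply => /andP[uw vw].
case/existsP=> z; rewrite negb_imply => /andP[vz uz].
by exists w, z; apply/and4P.
Qed.

Lemma row_subset_trans v u w :
  row_subset u v -> row_subset v w -> row_subset u w.
Proof.
move=> /forallP uv /forallP vw; apply/forallP=> t; apply/implyP=> ut.
by apply: implyP (vw t) _; apply: implyP (uv t) _.
Qed.

(** A column of [x] missed by [z], with a column of [y] missed by [x], separates [x] from both [y]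
    and [z]; hence [D x y] forces [D x z]. *)
Lemma orients_subset D x y z : orients M D ->
  row_subset y z -> D x y -> D z x -> False.
Proof.
case=> Dinc Danti _ Dinv /forallP yz Dxy Dzx; case/negP: (Danti _ _ Dzx).
case/incomparableP: (Dinc _ _ Dxy) => b [c /and4P[xb yc xc yb]].
case/incomparableP: (Dinc _ _ Dzx) => c' [b' /and4P[zc' xb' zb' xc']].
have yb' : ~~ M y b' by apply: contra zb'; apply/implyP.
have zc : M z c by apply: implyP (yz c) yc.
by apply: (Dinv x y x z b' c) => //; apply/and4P.
Qed.

(* Pairs of rows with comparable supports are ordered by inclusion; a triangle
   containing such a pair is never cyclic. *)
Lemma linear_order_of_orientation D :
  orients M D -> (forall x y z, D x y -> D y z -> ~~ D z x) ->
  exists r : rel T,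
    [/\ irreflexive r, transitive r,
        forall u v, u != v -> r u v || r v u &
        forall u v, inc u v -> r u v -> D u v].
Proof.
move=> oD acyc; case: (oD) => Dinc Danti Dtot Dinv.
pose rk (u : T) := nat_of_ord (enum_rank u).
(* Rows of equal support are ordered by rank. *)
pose S u v := row_subset u v && (~~ row_subset v u || (rk u < rk v)).
pose r u v := D u v || S u v.
have subinc u v : row_subset u v -> D u v || D v u -> False.
  move=> uv /orP[] /Dinc; rewrite incomparableE uv ?andbF //=.
have r_total u v : u != v -> r u v || r v u.
  move=> uv; have [/Dtot|] := boolP (inc u v); rewrite /r.
    by case/orP=> ->; rewrite ?orbT.
  rewrite incomparableE /S negb_and !negbK.
  case: (row_subset u v); case: (row_subset v u); rewrite ?orbT //= => _.
  have : rk u != rk v by apply: contra uv => /eqP/ord_inj/enum_rank_inj->.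
  by rewrite neq_ltn => /orP[] ->; rewrite ?orbT.
have S_trans v u w : S u v -> S v w -> S u w.
  move=> /andP[uv uv'] /andP[vw vw']; rewrite /S (row_subset_trans uv vw) /=.
  have [wu|//] := boolP (row_subset w u).
  rewrite (row_subset_trans vw wu) /= in uv'.
  rewrite (row_subset_trans wu uv) /= in vw'.
  exact: ltn_trans uv' vw'.
have S_anti u v : S u v -> S v u -> False.
  move=> /andP[uv h] /andP[vu h']; rewrite vu /= in h; rewrite uv /= in h'.
  by have := ltn_trans h h'; rewrite ltnn.
have r_irr : irreflexive r.
  move=> u; rewrite /r /S ltnn orbF andbN orbF.
  by apply/negP=> Duu; have := Danti _ _ Duu; rewrite Duu.
have r_anti u v : r u v -> r v u -> False.
  move=> /orP[uv|uv] /orP[vu|vu].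
  - by have := Danti _ _ uv; rewrite vu.
  - by case/andP: vu => /subinc vu _; apply: vu; rewrite uv orbT.
  - by case/andP: uv => /subinc uv _; apply: uv; rewrite vu orbT.
  - exact: S_anti uv vu.
have SSD x y z : S x y -> S y z -> D z x -> False.
  move=> /andP[xy _] /andP[yz _] zx.
  by apply: (subinc _ _ (row_subset_trans xy yz)); rewrite zx orbT.
have DSD x y z : D x y -> S y z -> D z x -> False.
  by move=> xy /andP[yz _]; apply: orients_subset yz xy.
have r_acyc x y z : r x y -> r y z -> r z x -> False.
  move=> /orP[xy|xy] /orP[yz|yz] /orP[zx|zx].
  - by have := acyc _ _ _ xy yz; rewrite zx.
  - exact: DSD yz zx xy.
  - exact: DSD xy yz zx.
  - exact: SSD yz zx xy.
  - exact: DSD zx xy yz.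
  - exact: SSD zx xy yz.
  - exact: SSD xy yz zx.
  - exact: S_anti (S_trans _ _ _ xy yz) zx.
exists r; split=> // [y x z xy yz|u v iuv /orP[//|/andP[/subinc uv _]]].
  (* A tournament without cyclic triangles is transitive. *)
  have [xz|xz] := eqVneq x z; first by case: (r_anti x y) => //; rewrite xz.
  by case/orP: (r_total _ _ xz) => // zx; case: (r_acyc _ _ _ xy yz zx).
by case: uv; apply: Dtot.
Qed.

(** * The lexicographic orientation of forcing classes *)

(** A two-digit number in base [#|T|], so that the order of naturals is the lexicographic one. *)
Definition lex_key (p : T * T) := enum_rank p.1 * #|T| + enum_rank p.2.

Lemma lex_key_fst p q : lex_key p <= lex_key q -> enum_rank p.1 <= enum_rank q.1.
Proof.
move/(leq_div2r #|T|); have T0 : 0 < #|T| by apply: leq_ltn_trans (ltn_ord (enum_rank p.1)).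
by rewrite !divnMDl // !divn_small ?addn0 // ltn_ord.
Qed.

Lemma lex_key_inj : injective lex_key.
Proof.
move=> p q e; have T0 : 0 < #|T| by apply: leq_ltn_trans (ltn_ord (enum_rank p.1)).
have e1 : p.1 = q.1.
  by apply/enum_rank_inj/ord_inj/eqP; rewrite eqn_leq !lex_key_fst ?e.
have e2 : p.2 = q.2.
  by move: e => /eqP; rewrite /lex_key e1 eqn_add2l => /eqP/ord_inj/enum_rank_inj.
by case: p q e1 e2 {e} => a b [a' b'] /= -> ->.
Qed.

(** A class is taken together with its reversal, so that [(u, v)] and [(v, u)] compete for one and
    the same smallest pair. *)
Definition lex_minimal (u v : T) p :=
  [forall q, ((u, v) ~~> q) || ((v, u) ~~> q) ==> (lex_key p <= lex_key q)].

(* Each class of forced pairs is oriented, as a whole, like its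
   lexicographically smallest pair. *)
Definition lex_orientation : rel T := fun u v =>
  inc u v && [exists p, ((u, v) ~~> p) && lex_minimal u v p].

Lemma lex_minimalC u v : lex_minimal u v =1 lex_minimal v u.
Proof. by move=> p; apply: eq_forallb => q; rewrite orbC. Qed.

Lemma lex_minimal_equiforced u v u' v' p :
  (u, v) ~~> (u', v') -> lex_minimal u v p -> lex_minimal u' v' p.
Proof.
move=> h /forallP m; apply/forallP=> q; apply/implyP=> hq.
apply: implyP (m q) _; case/orP: hq => hq.
  by rewrite (equiforced_trans h hq).
by rewrite (equiforced_trans (equiforced_swap h) hq) orbT.
Qed.

Hypothesis consistent : forall u v, inc u v -> ~~ ((u, v) ~~> (v, u)).

Lemma lex_orientation_orients : orients M lex_orientation.
Proof.
split.
- by move=> u v /andP[].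
- move=> u v /andP[iuv /existsP[p /andP[up mp]]]; apply/negP.
  case/andP=> _ /existsP[q /andP[vq mq]]; case/negP: (consistent iuv).
  suff pq : p = q by apply: equiforced_trans up _; rewrite pq equiforced_sym.
  apply: lex_key_inj; apply/eqP; rewrite eqn_leq.
  by rewrite (implyP (forallP mp q)) ?vq ?orbT // (implyP (forallP mq p)) ?up ?orbT.
- move=> u v iuv; rewrite /lex_orientation (incomparableC v) iuv /=.
  pose P p := ((u, v) ~~> p) || ((v, u) ~~> p).
  have P0 : P (u, v) by rewrite /P equiforced_refl.
  case: (arg_minnP lex_key P0) => p Pp minp.
  have mp : lex_minimal u v p by apply/forallP=> q; apply/implyP; apply: minp.
  case/orP: Pp => hp; apply/orP; [left|right]; apply/existsP; exists p.
    by rewrite hp.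
  by rewrite hp lex_minimalC.
- move=> u v u' v' w z s s' /andP[_ /existsP[p /andP[up mp]]].
  have h := separates_equiforced s s'.
  apply/andP; split; first by apply/incomparableP; exists w, z.
  apply/existsP; exists p; rewrite (lex_minimal_equiforced h) // andbT.
  by apply: equiforced_trans up; rewrite equiforced_sym.
Qed.

Local Notation D := lex_orientation.

Lemma induced_matching_rot x y z p b c :
  induced_matching M x y z p b c -> induced_matching M z x y c p b.
Proof.
case/and5P=> xp yb zc /and3P[xb xc yp] /and3P[yc zp zb].
by apply/and5P; split=> //; apply/and3P.
Qed.

(* If the smallest pair [(a, b)] of the class of [(y, z)] precedes that of the
   class of [(x, y)], then [(a, x)] lies in the latter up to reversal, so the
   smallest pair there starts with [a] too, and the triangle lemma with apex [b]
   reverses [(a, b)]. *)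
Lemma lex_orientation_no_descent x y z p b c p1 p2 :
  induced_matching M x y z p b c -> D x y -> D y z -> D z x ->
  (x, y) ~~> p1 -> lex_minimal x y p1 -> (y, z) ~~> p2 ->
  lex_key p1 < lex_key p2.
Proof.
move=> m xy yz zx; have oD := lex_orientation_orients.
have Danti : forall u v, D u v -> ~~ D v u by case: oD.
have no_rev u v u' v' : D u v -> D v' u' -> ~~ ((u, v) ~~> (u', v')).
  move=> Duv /Danti; apply: contra => h; exact: orients_equiforced oD h Duv.
case: p1 p2 => [a1 b1] [a2 b2] xy1 min1 yz2; rewrite ltnNge; apply/negP=> le21.
have [] := triangle_lemma m _ _ yz2; try exact: no_rev.
move=> b' [c' [m' xy2 xz2]].
have xa : D x a2 := orients_equiforced oD xy2 xy.
have ab : D a2 b2 := orients_equiforced oD yz2 yz.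
have bx : D b2 x := orients_equiforced oD (equiforced_swap xz2) zx.
have le12 : lex_key (a1, b1) <= lex_key (a2, x).
  by apply: implyP (forallP min1 _) _; rewrite (equiforced_swap xy2) orbT.
have a12 : a1 = a2.
  apply/enum_rank_inj/ord_inj/eqP; rewrite eqn_leq.
  by rewrite (lex_key_fst le12) (lex_key_fst le21).
have xa1 : (x, a2) ~~> (a2, b1).
  by rewrite equiforced_sym in xy2; apply: equiforced_trans xy2 _; rewrite -a12.
have [] := triangle_lemma (induced_matching_rot m') _ _ xa1; try exact: no_rev.
move=> _ [_ [_ /(orients_equiforced oD)/(_ bx) ba _]].
by have := Danti _ _ ab; rewrite ba.
Qed.

(** The key of the smallest pair would strictly increase along all three arcs of the cycle. *)
Lemma lex_orientation_no_matching x y z p b c :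
  induced_matching M x y z p b c -> D x y -> D y z -> D z x -> False.
Proof.
move=> m1 xy yz zx.
have m3 := induced_matching_rot m1; have m2 := induced_matching_rot m3.
case/andP: (xy) => _ /existsP[p1 /andP[c1 min1]].
case/andP: (yz) => _ /existsP[p2 /andP[c2 min2]].
case/andP: (zx) => _ /existsP[p3 /andP[c3 min3]].
have lt12 := lex_orientation_no_descent m1 xy yz zx c1 min1 c2.
have lt23 := lex_orientation_no_descent m2 yz zx xy c2 min2 c3.
have lt31 := lex_orientation_no_descent m3 zx xy yz c3 min3 c1.
by have := ltn_trans (ltn_trans lt12 lt23) lt31; rewrite ltnn.
Qed.

End Rows.

(** * Invariance under the bipartite complement *)

Lemma incomparable_complement (T U : finType) (M : T -> U -> bool) u v :
  incomparable (complement M) u v = incomparable M u v.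
Proof.
apply/incomparableP/incomparableP => [] [w [z h]]; exists z, w.
  by rewrite -separates_complement.
by rewrite separates_complement.
Qed.

Lemma equiforced_complement (T U : finType) (M : T -> U -> bool) :
  equiforced (complement M) =2 equiforced M.
Proof.
apply: eq_connect => -[u v] [u' v'].
apply/forcingP/forcingP => [] [w [z [h h']]]; exists z, w.
  by rewrite -!(separates_complement M).
by rewrite !separates_complement.
Qed.

Lemma lex_orientation_complement (T U : finType) (M : T -> U -> bool) :
  lex_orientation (complement M) =2 lex_orientation M.
Proof.
move=> u v; rewrite /lex_orientation incomparable_complement; congr (_ && _).
apply: eq_existsb => p; rewrite equiforced_complement; congr (_ && _).
by apply: eq_forallb => q; rewrite !equiforced_complement.
Qed.

Lemma lex_orientation_acyclic (T U : finType) (M : T -> U -> bool) :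
  (forall u v, incomparable M u v -> ~~ equiforced M (u, v) (v, u)) ->
  forall x y z, lex_orientation M x y -> lex_orientation M y z ->
    ~~ lex_orientation M z x.
Proof.
move=> cons x y z xy yz; apply/negP=> zx.
have oD := lex_orientation_orients cons.
have [p [b [c [|]]]] := cyclic_triangle_matching oD xy yz zx.
  by move/lex_orientation_no_matching; apply.
(* Complementing [M] just exchanges the two columns of a pattern, so classes and orientation are
   unchanged and the 3K2 case applies to the complement. *)
move/lex_orientation_no_matching; apply; rewrite ?lex_orientation_complement //.
by move=> u v; rewrite incomparable_complement equiforced_complement; apply: cons.
Qed.

(** * Transport of the orientation from rows to columns *)

Section Columns.
Variables (T U : finType) (M : T -> U -> bool) (D : rel T).
Hypothesis oD : orients M D.
Hypothesis D_acyclic : forall x y z, D x y -> D y z -> ~~ D z x.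

Definition transpose : U -> T -> bool := fun w u => M u w.

(** No separate lexicographic choice is made for columns, since each induced 2K2 has to orient its
    rows and its columns alike. *)
Definition column_orientation : rel U :=
  fun w z => [exists u, exists v, separates M u v w z && D u v].

Lemma separates_transpose u v w z :
  separates transpose w z u v = separates M u v w z.
Proof. by rewrite /separates [~~ M v w && _]andbC. Qed.

Lemma column_orientationP w z :
  reflect (exists u v, separates M u v w z /\ D u v) (column_orientation w z).
Proof.
apply: (iffP existsP) => [[u /existsP[v /andP[h h']]]|[u [v [h h']]]].
  by exists u, v.
by exists u; apply/existsP; exists v; apply/andP.
Qed.

(** Invariance of [D] under forcing makes the value independent of the separating rows. *)
Lemma column_orientationE u v w z :
  separates M u v w z -> column_orientation w z = D u v.
Proof.
case: oD => _ _ _ Dinv h; apply/column_orientationP/idP => [[u' [v' [h' d]]]|d].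
  exact: Dinv h' h d.
by exists u, v.
Qed.

Lemma column_orientation_orients : orients transpose column_orientation.
Proof.
case: oD => Dinc Danti Dtot Dinv; split.
- move=> w z /column_orientationP[u [v [h _]]]; apply/incomparableP.
  by exists u, v; rewrite separates_transpose.
- move=> w z /column_orientationP[u [v [h d]]].
  by rewrite separatesC in h; rewrite (column_orientationE h) Danti.
- move=> w z /incomparableP[u [v]]; rewrite separates_transpose => h.
  rewrite (column_orientationE h); rewrite separatesC in h.
  rewrite (column_orientationE h); rewrite separatesC in h.
  by apply: Dtot; apply/incomparableP; exists w, z.
- move=> w z w' z' u v; rewrite !separates_transpose => h h'.
  by rewrite (column_orientationE h) (column_orientationE h').
Qed.

(** The three rows matched to a cyclic triangle of columns form a cyclic triangle of [D], traversed
    backwards in the complement case. *)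
Lemma column_orientation_acyclic x y z :
  column_orientation x y -> column_orientation y z -> ~~ column_orientation z x.
Proof.
move=> xy yz; apply/negP=> zx.
have [p [b [c [|]]]] := cyclic_triangle_matching column_orientation_orients xy yz zx.
  case/and5P=> xp yb zc /and3P[xb xc yp] /and3P[yc zp zb].
  have pb : D p b by rewrite -(@column_orientationE p b x y) //; apply/and4P.
  have bc : D b c by rewrite -(@column_orientationE b c y z) //; apply/and4P.
  have cp : D c p by rewrite -(@column_orientationE c p z x) //; apply/and4P.
  by case/negP: (D_acyclic pb bc).
rewrite /induced_matching /complement !negbK.
case/and5P=> xp yb zc /and3P[xb xc yp] /and3P[yc zp zb].
have bp : D b p by rewrite -(@column_orientationE b p x y) //; apply/and4P.
have cb : D c b by rewrite -(@column_orientationE c b y z) //; apply/and4P.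
have pc : D p c by rewrite -(@column_orientationE p c z x) //; apply/and4P.
by case/negP: (D_acyclic pc cb).
Qed.

End Columns.

(** The two linear orders extend orientations that agree on every induced 2K2, so the edges of a 2K2
    never cross. *)
Lemma exists_separated_free_orders (T U : finType) (M : T -> U -> bool) :
  (forall u v, incomparable M u v -> ~~ equiforced M (u, v) (v, u)) ->
  exists (r : rel T) (s : rel U),
    [/\ [/\ irreflexive r, transitive r & forall u v, u != v -> r u v || r v u],
        [/\ irreflexive s, transitive s & forall w z, w != z -> s w z || s z w] &
        forall u v w z, r u v -> s w z -> ~~ separates M u v z w].
Proof.
move=> cons; have oD := lex_orientation_orients cons.
have acyc := lex_orientation_acyclic cons.
have oC := column_orientation_orients oD.
have [r [r1 r2 r3 rD]] := linear_order_of_orientation oD acyc.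
have [s [s1 s2 s3 sD]] :=
  linear_order_of_orientation oC (column_orientation_acyclic oD acyc).
exists r, s; split=> // u v w z uv wz; apply/negP=> h.
have Duv : lex_orientation M u v by apply: rD uv; apply/incomparableP; exists z, w.
have : column_orientation M (lex_orientation M) w z.
  by apply: sD wz; apply/incomparableP; exists v, u; rewrite separates_transpose separatesC.
rewrite separatesC in h; rewrite (column_orientationE oD h); apply/negP.
by case: oD => _ Danti _ _; apply: Danti.
Qed.

(** * The auxiliary graph in terms of 2K2 patterns *)

Section Bigraph.
Variables (V : finType) (e : rel V) (X Y : {set V}).
Hypotheses (e_sym : symmetric e) (XY_bip : bipartition e X Y).
Local Notation aux := (@aux_graph V e X Y).

Lemma bipartition_mem (W : finType) (f : rel W) (A B : {set W}) x :
  bipartition f A B -> (x \in B) = (x \notin A).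
Proof.
case=> AB dAB _; have := in_setT x; rewrite -AB inE.
by have [xA _|] := boolP (x \in A); first exact: (disjointFr dAB).
Qed.

Lemma bipartition_edge (W : finType) (f : rel W) (A B : {set W}) x y :
  bipartition f A B -> f x y -> (y \in A) = (x \notin A).
Proof.
move=> bip xy; case: (bip) => _ _ /(_ _ _ xy).
by rewrite !(bipartition_mem _ bip) => -[] [] => [-> /negbTE|/negbTE-> ->].
Qed.

Lemma same_side_nonadjacent x y : (x \in X) = (y \in X) -> ~~ e x y.
Proof.
by move=> xy; apply/negP=> /(bipartition_edge XY_bip); rewrite xy; case: (y \in X).
Qed.

Lemma same_side_pairE u v :
  same_side_pair X Y (u, v) = (u != v) && ((u \in X) == (v \in X)).
Proof.
rewrite /same_side_pair /= !(bipartition_mem _ XY_bip).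
by case: (u \in X); case: (v \in X).
Qed.

Lemma aux_vertex_side (p : aux_vertex X Y) : ((val p).1 \in X) = ((val p).2 \in X).
Proof. by case: p => [[u v] /= h]; move: h; rewrite same_side_pairE => /andP[_ /eqP]. Qed.

Lemma independent_XYE x y x' y' :
  independent_XY e X Y x y x' y' =
  [&& x \in X, x' \in X & separates e x x' y y'].
Proof.
rewrite /independent_XY /separates.
case xX: (x \in X) => //=; case x'X: (x' \in X) => //=.
have [xy|] := boolP (e x y); last by rewrite !andbF.
have [x'y'|] := boolP (e x' y'); last by rewrite !andbF.
have yX := bipartition_edge XY_bip xy; have y'X := bipartition_edge XY_bip x'y'.
rewrite !(bipartition_mem _ XY_bip) yX y'X xX x'X /=.
have [xy'|xy'] := boolP (e x y'); first by rewrite /= andbF.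
suff -> : [disjoint [set x; y] & [set x'; y']] by [].
rewrite -setI_eq0; apply/eqP/setP=> t; rewrite !inE; apply/negP.
case/andP=> /orP[] /eqP-> /orP[] /eqP E.
- by rewrite E x'y' in xy'.
- by rewrite -E xX x'X in y'X.
- by rewrite E x'X xX in yX.
- by rewrite -E xy in xy'.
Qed.

(** The two cases of [independent] are one pattern read from either side, and exactly one end of the
    edge [u w] lies in [X]. *)
Lemma aux_graphE (p q : aux_vertex X Y) :
  aux p q = (val q == ((val p).2, (val p).1)) ||
            separates e (val p).1 (val p).2 (val q).2 (val q).1.
Proof.
have := aux_vertex_side p; have := aux_vertex_side q; rewrite /aux_graph.
case: (val p) (val q) => [u v] [z w] /= zw uv; congr (_ || _).
rewrite /independent !independent_XYE.
have -> : separates e w z u v = separates e u v w z.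
  by rewrite /separates !(e_sym w) !(e_sym z) [X in _ && (_ && X)]andbC.
have [s|] := boolP (separates e u v w z); last by rewrite !andbF.
case/and4P: s => uw _ _ _; rewrite !andbT -uv zw (bipartition_edge XY_bip uw).
by case: (u \in X).
Qed.

(** * Weak edge-asteroids from odd cycles *)

(* A reversal step carries no edge of the graph and borrows one from the next
   step [q -> r], which cannot be a reversal as well. *)
Definition step_edge (p q r : V * V) : V * V :=
  if q == (p.2, p.1) then (q.2, r.1) else (p.1, q.2).

Definition aux_step (p q : V * V) : Prop :=
  q = (p.2, p.1) \/ separates e p.1 p.2 q.2 q.1.

Definition balanced (p : V * V) := (p.1 \in X) = (p.2 \in X).

Lemma step_edgeP p q r : aux_step p q -> aux_step q r -> r <> p ->
  e (step_edge p q r).1 (step_edge p q r).2.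
Proof.
rewrite /step_edge => pq qr rp; case: eqP => [E|E] /=.
  case: qr => [E'|/and4P[_ //]].
  by case: rp; rewrite E' E; case: p {pq E E'}.
by case: pq => // /and4P[].
Qed.

(* The walk avoiding the edge at step [p1 -> p2] runs through [p0.1], [p1.2],
   [p2.1], [p3.2], [p4.1], where steps that are reversals repeat a vertex. *)
Lemma step_edge_walk p0 p1 p2 p3 p4 :
  balanced p0 -> balanced p1 -> balanced p2 -> balanced p3 -> balanced p4 ->
  aux_step p0 p1 -> aux_step p1 p2 -> aux_step p2 p3 -> aux_step p3 p4 ->
  p2 <> p0 -> p3 <> p1 -> p4 <> p2 ->
  let f := step_edge p1 p2 p3 in
  let a := step_edge p0 p1 p2 in
  let b := step_edge p2 p3 p4 in
  exists x (s : seq V),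
    [/\ path e x s,
        {subset [:: a.1; a.2; b.1; b.2] <= x :: s} &
        {in x :: s, forall z, ~~ e z f.1 && ~~ e z f.2}].
Proof.
case: p0 p1 p2 p3 p4 => [u0 v0] [u1 v1] [u2 v2] [u3 v3] [u4 v4].
rewrite /balanced /aux_step /step_edge /= => b0 b1 b2 b3 b4.
have swapped u v w z : separates e u v w z -> ((z, w) == (v, u)) = false.
  move=> /and4P[uw _ _ vw]; apply/eqP=> -[_ E]; move: uw.
  by rewrite E; apply/negP/same_side_nonadjacent.
have side u v w z : separates e u v w z -> (w \in X) = (u \notin X).
  by move=> /and4P[uw _ _ _]; apply: bipartition_edge XY_bip uw.
have negnegX t : ~~ (t \notin X) = (t \in X) by rewrite negbK.
case=> [[E0 E0']|s0] [[E1 E1']|s1] [[E2 E2']|s2] [[E3 E3']|s3] n02 n13 n24;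
  try (by case: n02; congruence); try (by case: n13; congruence);
  try (by case: n24; congruence); subst; rewrite ?eqxx ?(swapped _ _ _ _ s0)
  ?(swapped _ _ _ _ s1) ?(swapped _ _ _ _ s2) ?(swapped _ _ _ _ s3) /=.
all: try (move: (side _ _ _ _ s0) => ?; case/and4P: s0 => ? ? ? ?).
all: try (move: (side _ _ _ _ s1) => ?; case/and4P: s1 => ? ? ? ?).
all: try (move: (side _ _ _ _ s2) => ?; case/and4P: s2 => ? ? ? ?).
all: try (move: (side _ _ _ _ s3) => ?; case/and4P: s3 => ? ? ? ?).
(* Eight patterns without two successive reversals remain. The walk visits [u4] separately only when
   the step from [p2] to [p3] is a reversal. *)
1: exists u0, [:: u2; u4].
2,3: exists u0, [:: u2; v3].
4,5: exists u0, [:: v1; v3].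
6: exists u0, [:: v1; u2; u4].
7,8: exists u0, [:: v1; u2; v3].
all: split; [by rewrite /= ?andbT; repeat (apply/andP; split) => //; rewrite e_sym
  |by move=> t; rewrite !inE; do ?[case/orP | move=> /eqP->]; rewrite ?eqxx ?orbT
  |move=> t; rewrite !inE => h; apply/andP].
all: move: h; do ?[case/orP]; move/eqP=> ->; split.
all: try by [].
all: try by rewrite e_sym.
(* The non-adjacencies not read off a 2K2 join vertices on the same side. *)
all: apply: same_side_nonadjacent.
all: have n0 := negnegX u0; congruence.
Qed.

Lemma aux_graph_step (p q : aux_vertex X Y) : aux p q -> aux_step (val p) (val q).
Proof. by rewrite aux_graphE => /orP[/eqP|]; [left|right]. Qed.

Lemma odd_cycle_asteroid (c : seq (aux_vertex X Y)) : odd_cycle aux c ->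
  exists (k : nat) (f : 'I_(k.*2.+1) -> V * V),
    weak_edge_asteroid e f /\ forall i, edge_of_cycle c (f i).
Proof.
case=> c_gt2 c_odd /andP[cyc c_uniq].
have [p0 _] : exists p, p \in c.
  by case: (c) c_gt2 => // p s _; exists p; rewrite mem_head.
pose k := (size c)./2; pose n := k.*2.+1.
have size_c : size c = n by rewrite /n /k -[LHS]odd_double_half c_odd.
rewrite size_c in c_gt2.
pose P j := nth p0 c (j %% n).
have P_mod i j : i = j %[mod n] -> P i = P j by rewrite /P => ->.
have P_in j : P j \in c by rewrite mem_nth // size_c ltn_mod.
have P_next j : next c (P j) = P j.+1.
  rewrite next_nth P_in index_uniq // ?size_c ?ltn_mod // /P -addn1 -modnDml.
  case Ec: c size_c => [//|x s] /= [size_s]; have := ltn_pmod j (ltn0Sn k.*2).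
  (* At the last index [nth] overruns the tail and returns its default, the head of the cycle. *)
  rewrite -/n addn1 ltnS leq_eqVlt => /orP[/eqP->|lt_j].
    by rewrite modnn nth_default // size_s.
  rewrite [_.+1 %% n]modn_small //=; apply: set_nth_default.
  by rewrite size_s.
have P_step j : aux_step (val (P j)) (val (P j.+1)).
  by apply: aux_graph_step; rewrite -P_next; apply: next_cycle.
have P_bal j : balanced (val (P j)) by apply: aux_vertex_side.
(* As [2 < n] and the cycle has no repetition, two successive steps are never both reversals. *)
have P_turn j : val (P j.+2) <> val (P j).
  move=> /val_inj/eqP; rewrite nth_uniq ?size_c ?ltn_mod //.
  by rewrite -addn2 -[X in _ == X %[mod _]]addn0 eqn_modDl mod0n modn_small.
pose g j := step_edge (val (P j)) (val (P j.+1)) (val (P j.+2)).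
have g_mod i j : i = j %[mod n] -> g i = g j.
  move=> ij; have ijD t : i + t = j + t %[mod n].
    by apply/eqP; rewrite eqn_modDr; apply/eqP.
  rewrite /g (P_mod _ _ ij); have := P_mod _ _ (ijD 1); rewrite !addn1 => ->.
  by have := P_mod _ _ (ijD 2); rewrite !addn2 => ->.
(* With [n = 2 k + 1], the indices [2 (i + k)] and [2 (i + k + 1)] are the
   neighbours of [2 i] modulo [n]. *)
exists k, (fun i => g i.*2); split; last first.
  move=> i; rewrite /g /step_edge; case: eqP => _.
    exists (P i.*2.+1) => //; rewrite P_next.
    by case: (val (P i.*2.+1)) (val (P i.*2.+2)) => [u v] [z w]; right.
  exists (P i.*2) => //; rewrite P_next.
  by case: (val (P i.*2)) (val (P i.*2.+1)) => [u v] [z w]; left.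
split.
- by move: c_gt2; rewrite /n; case: (k).
- by move=> i; apply: step_edgeP.
move=> i; cbv zeta.
rewrite !inordK ?ltn_mod //.
have dbl_mod j : g (j %% n).*2 = g j.*2.
  by apply: g_mod; rewrite -!muln2 modnMml.
rewrite -/n !dbl_mod.
(* The index on the right is [i.*2 + n]; the five vertices used start at [P (i + k).*2]. *)
have -> : g i.*2 = g (i + k).*2.+1.
  by apply: g_mod; rewrite doubleD -addnS modnDr.
by rewrite addnS doubleS; apply: step_edge_walk.
Qed.

(** * Orderings of the two sides versus 2-colourings of the auxiliary graph *)

Lemma strict_linear_order_swap (A : {set V}) (r : rel V) u v :
  strict_linear_order_on A r -> u \in A -> v \in A -> u != v -> r v u = ~~ r u v.
Proof.
case=> irr tr tot uA vA uv.
have anti : r u v -> r v u -> False.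
  by move=> h h'; have := tr _ _ _ vA uA uA h h'; rewrite irr.
case/orP: (tot _ _ uA vA uv) => h; rewrite h.
  by apply/negP=> h'; apply: anti.
by apply/esym/negP=> h'; apply: anti.
Qed.

(** Pairs are coloured by whether they are increasing. If [(u, v)] and [(z, w)] were both increasing
    or both decreasing, the independent edges [u w] and [v z] would cross. *)
Lemma cocomparability_bipartite : cocomparability_bigraph e X Y -> bipartite aux.
Proof.
case=> ltX [ltY [linX linY cocomp]].
pose lt u v := if u \in X then ltX u v else ltY u v.
have lt_swap u v : same_side_pair X Y (u, v) -> lt v u = ~~ lt u v.
  rewrite same_side_pairE /lt => /andP[uv /eqP uvX]; rewrite -uvX.
  case: ifP => uX; first by apply: strict_linear_order_swap linX _ _ uv; rewrite -?uvX.
  by apply: strict_linear_order_swap linY _ _ uv;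
     rewrite (bipartition_mem _ XY_bip) -?uvX uX.
have no_sep u v w z : u \in X -> v \in X -> w \in Y -> z \in Y ->
    separates e u v z w -> ltX u v -> ltY w z -> False.
  move=> uX vX wY zY /and4P[uz vw uw vz] uv wz.
  by case: (cocomp _ _ _ _ uX vX wY zY uv wz uz vw); apply/negP.
pose A := [set p : aux_vertex X Y | lt (val p).1 (val p).2].
have flip (p q : aux_vertex X Y) : aux p q ->
    lt (val q).1 (val q).2 = ~~ lt (val p).1 (val p).2.
  rewrite aux_graphE => /orP[/eqP-> /=|]; first by apply: lt_swap; case: p => -[].
  case: p q => [[u v] /= puv] [[z w] /= pzw]; move: (puv) (pzw).
  rewrite !same_side_pairE => /andP[_ /eqP uvX] /andP[_ /eqP zwX] s.
  have uz : (w \in X) = (u \notin X).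
    by case/and4P: s => uw _ _ _; apply: bipartition_edge XY_bip uw.
  apply/idP/negP => [zw uv|].
    move: uv zw; rewrite /lt zwX uz; case: ifP => uX /= uv zw.
      apply: (no_sep u v z w) uv zw; rewrite -?uvX ?(bipartition_mem _ XY_bip) //.
        by rewrite zwX uz uX.
      by rewrite uz uX.
    apply: (no_sep z w u v) zw uv; rewrite ?zwX ?uz ?uX //.
    - by rewrite (bipartition_mem _ XY_bip) uX.
    - by rewrite (bipartition_mem _ XY_bip) -uvX uX.
    - by case/and4P: s => uw vz nuz nvw; apply/and4P; rewrite !(e_sym z) !(e_sym w).
  move/negP; rewrite -(lt_swap _ _ puv) => vu.
  rewrite -[lt z w]negbK -(lt_swap _ _ pzw); apply/negP=> wz.
  rewrite separatesC in s.
  move: vu wz; rewrite /lt uz -uvX; case: ifP => uX /= vu wz.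
    apply: (no_sep v u w z) vu wz; rewrite -?uvX ?(bipartition_mem _ XY_bip) //.
      by rewrite uz uX.
    by rewrite zwX uz uX.
  apply: (no_sep w z v u) wz vu; rewrite ?zwX ?uz ?uX //.
  - by rewrite (bipartition_mem _ XY_bip) -uvX uX.
  - by rewrite (bipartition_mem _ XY_bip) uX.
  - by case/and4P: s => uw vz nuz nvw; apply/and4P; rewrite !(e_sym z) !(e_sym w).
exists A, (~: A); split; first exact: setUCr.
  by rewrite -setI_eq0 setICr.
move=> p q /flip; rewrite !inE => ->.
by case: (lt _ _); [left|right].
Qed.

Lemma bipartite_cocomparability : bipartite aux -> cocomparability_bigraph e X Y.
Proof.
case=> A [B AB].
(* Rows outside [X] are made zero, so that all of [V] can index both rows and columns. *)
pose M u w := (u \in X) && e u w.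
have sepM u v w z : separates M u v w z = [&& u \in X, v \in X & separates e u v w z].
  by rewrite /separates /M; case: (u \in X); case: (v \in X); rewrite ?andbF.
have pairs u v w z : separates M u v w z ->
    exists q r : aux_vertex X Y, val q = (u, v) /\ val r = (z, w).
  have vertex p : same_side_pair X Y p -> exists q : aux_vertex X Y, val q = p.
    by move=> h; exists (Sub p h); rewrite SubK.
  rewrite sepM => /and3P[uX vX /and4P[uw vz uz vw]].
  have [|q qE] := vertex (u, v).
    by rewrite same_side_pairE uX vX andbT; apply: contraNneq vw => <-.
  have [|r rE] := vertex (z, w); last by exists q, r.
  rewrite same_side_pairE (bipartition_edge XY_bip uw) (bipartition_edge XY_bip vz).
  by rewrite uX vX andbT; apply: contraNneq uz => ->.
pose colour p := [exists q in A, val q == p].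
have colourE (q : aux_vertex X Y) : colour (val q) = (q \in A).
  apply/existsP/idP => [[r /andP[rA /eqP/val_inj <-//]]|qA].
  by exists q; rewrite qA eqxx.
have colour_sep u v w z : separates M u v w z -> colour (u, v) = ~~ colour (z, w).
  move=> s; have [q [r [qE rE]]] := pairs _ _ _ _ s; rewrite -qE -rE !colourE.
  have /(bipartition_edge AB) -> : aux q r.
    by rewrite aux_graphE qE rE; move: s; rewrite sepM => /and3P[_ _ ->]; rewrite orbT.
  by rewrite negbK.
have colour_eq p q : equiforced M p q -> colour p = colour q.
  case/connectP=> s; elim: s p => [|q' s IH] p /=; first by move=> _ ->.
  case/andP=> + ps def; rewrite -(IH _ ps def).
  case: p q' {IH ps def} => [u v] [u' v'] /forcingP[w [z [h h']]].
  by rewrite (colour_sep _ _ _ _ h) (colour_sep _ _ _ _ h').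
have [|r [s [[r1 r2 r3] [s1 s2 s3] rs]]] := @exists_separated_free_orders _ _ M.
  (* A pair is adjacent to its reversal, hence of the other colour, while colours are constant on
     classes. *)
  move=> u v /incomparableP[w [z h]]; apply/negP=> /colour_eq.
  have [q [_ [qE _]]] := pairs _ _ _ _ h; rewrite separatesC in h.
  have [r [_ [rE _]]] := pairs _ _ _ _ h; rewrite -qE -rE !colourE.
  have /(bipartition_edge AB) -> : aux q r by rewrite aux_graphE qE rE eqxx.
  by case: (_ \in A).
exists r, s; split.
- by split=> [u _|u v w _ _ _|u v _ _]; [exact: r1|exact: r2|exact: r3].
- by split=> [u _|u v w _ _ _|u v _ _]; [exact: s1|exact: s2|exact: s3].
move=> u v w z uX vX _ _ uv wz uz vw; have := rs _ _ _ _ uv wz.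
rewrite sepM uX vX /separates uz vw /=.
by rewrite negb_and !negbK => /orP.
Qed.

End Bigraph.

Theorem theorem4p1 (V : finType) (e : rel V) (X Y : {set V})
    (e_sym : symmetric e) (e_irr : irreflexive e)
    (XY_bip : bipartition e X Y) :
  (cocomparability_bigraph e X Y <-> bipartite (@aux_graph V e X Y)) /\
  (~ bipartite (@aux_graph V e X Y) ->
   forall c : seq (aux_vertex X Y),
     odd_cycle (@aux_graph V e X Y) c ->
     exists (k : nat) (f : 'I_(k.*2.+1) -> V * V),
       weak_edge_asteroid e f /\ forall i, edge_of_cycle c (f i)).
Proof.
split; last by move=> _ c; apply: odd_cycle_asteroid.
split; first exact: cocomparability_bipartite.
exact: bipartite_cocomparability.
Qed.
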